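(* Let $(a_n)_{n\ge 0}$, $(b_n)_{n\ge 0}$, $(c_n)_{n\ge 0}$, $(d_n)_{n\ge 0}$ be two-periodic sequences of positive real numbers, with $a_{2n}=a_0$, $a_{2n+1}=a_1$, $b_{2n}=b_0$, $b_{2n+1}=b_1$, $c_{2n}=c_0$, $c_{2n+1}=c_1$, $d_{2n}=d_0$, $d_{2n+1}=d_1$ for all $n\ge 0$, where $a_0\neq a_1$, $b_0\neq b_1$, $c_0\neq c_1$, $d_0\neq d_1$. Consider solutions $(x_n,y_n)_{n\ge 0}$, with initial values $x_0,y_0>0$, of the system $$x_{n+1}=\frac{a_n}{x_n}+\frac{b_n}{y_n},\qquad y_{n+1}=\frac{c_n}{x_n}+\frac{d_n}{y_n},\qquad n\in\mathbb{N}_0.$$ Assume that $$\operatorname{rank}\begin{pmatrix} a_1d_0+b_0b_1 & a_0b_1+a_1c_0\\ b_0d_1+c_1d_0 & a_0d_1+c_0c_1\end{pmatrix}=2,$$ and let $\lambda_1$, $C_1$, $C_3$ be the quantities defined in the context. Then, for the solutions of the system, the following are true: (i) If $\dfrac{C_1\lambda_1}{C_3}-\left(b_0\dfrac{C_1}{C_3}+a_0\right)\left(d_0\dfrac{C_1}{C_3}+c_0\right)<0$, then $x_{2n}\to 0$, $x_{2n+1}\to\infty$, $y_{2n}\to 0$, $y_{2n+1}\to\infty$ as $n\to\infty$. (ii) If $\dfrac{C_1\lambda_1}{C_3}-\left(b_0\dfrac{C_1}{C_3}+a_0\right)\left(d_0\dfrac{C_1}{C_3}+c_0\right)>0$, then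 $x_{2n}\to\infty$, $x_{2n+1}\to 0$, $y_{2n}\to\infty$, $y_{2n+1}\to 0$ as $n\to\infty$. (iii) If $\dfrac{C_1\lambda_1}{C_3}-\left(b_0\dfrac{C_1}{C_3}+a_0\right)\left(d_0\dfrac{C_1}{C_3}+c_0\right)=0$, then every solution of the system (with $x_0,y_0>0$) converges to a two-periodic positive solution of the system.
   Context: $\mathbb{N}_0=\{0,1,2,\dots\}$. A solution $(x_n,y_n)_{n\ge 0}$ is periodic with period $p$ if $(x_{n+p},y_{n+p})=(x_n,y_n)$ for all $n\ge 0$; two-periodic means periodic with period $p=2$. A solution $(x_n,y_n)$ converges to a solution $(X_n,Y_n)$ if $x_n-X_n\to 0$ and $y_n-Y_n\to 0$ as $n\to\infty$. The quantities $\lambda_1,\lambda_2$ (the eigenvalues of the matrix in the rank condition) are $$\lambda_1=\frac{a_1d_0+b_0b_1+a_0d_1+c_0c_1+\sqrt{\left(a_1d_0+b_0b_1-a_0d_1-c_0c_1\right)^2+4\left(a_0b_1+a_1c_0\right)\left(b_0d_1+c_1d_0\right)}}{2},$$ $$\lambda_2=\frac{a_1d_0+b_0b_1+a_0d_1+c_0c_1-\sqrt{\left(a_1d_0+b_0b_1-a_0d_1-c_0c_1\right)^2+4\left(a_0b_1+a_1c_0\right)\left(b_0d_1+c_1d_0\right)}}{2}.$$ With $u_0=x_0$ and $v_0=y_0$, $$C_1=\frac{a_0b_1+a_1c_0}{\lambda_1-\lambda_2}\left(\frac{b_0d_1+c_1d_0}{\lambda_1-\left(a_1d_0+b_0b_1\right)}u_0+v_0\right),$$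 $$C_3=\frac{b_0d_1+c_1d_0}{\lambda_1-\lambda_2}u_0+\frac{\lambda_1-\left(a_1d_0+b_0b_1\right)}{\lambda_1-\lambda_2}v_0.$$ *)

(* Defs.v *)
From HB Require Import structures.
From mathcomp Require Import all_boot all_order all_algebra.
From mathcomp Require Import all_classical all_reals all_analysis.

Set Implicit Arguments.
Unset Strict Implicit.
Unset Printing Implicit Defensive.

Import Order.TTheory GRing.Theory Num.Theory.
Import numFieldNormedType.Exports.

Local Open Scope classical_set_scope.
Local Open Scope ring_scope.

(* [p] is a period of [u], not necessarily the least one. *)
Definition periodic_seq (T : Type) (p : nat) (u : nat -> T) : Prop :=
  forall n, u (n + p)%N = u n.

(* Division is total, with [z / 0 = 0]; the positivity of [x 0] and [y 0] is
   not part of the definition and is assumed wherever it is needed. With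
   positive coefficients it propagates to all indices. *)
Definition is_solution (R : realType) (a b c d x y : nat -> R) : Prop :=
  forall n, x n.+1 = a n / x n + b n / y n /\ y n.+1 = c n / x n + d n / y n.

Definition converges_to (R : realType) (x y X Y : nat -> R) : Prop :=
  x n - X n @[n --> \oo] --> (0 : R) /\ y n - Y n @[n --> \oo] --> (0 : R).

Section Constants.
Variables (R : realType) (a b c d : nat -> R).

(* The product [M 1 *m M 0], where [M k] has rows [(b k, a k)] and
   [(d k, c k)]; [M (odd k)] sends the direction of [(x k, y k)] to that of
   [(x k.+1, y k.+1)]. *)
Definition two_step_mx : 'M[R]_2 :=
  \matrix_(i < 2, j < 2)
    if i == 0 then
      if j == 0 then a 1%N * d 0%N + b 0%N * b 1%N
      else a 0%N * b 1%N + a 1%N * c 0%N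
    else
      if j == 0 then b 0%N * d 1%N + c 1%N * d 0%N
      else a 0%N * d 1%N + c 0%N * c 1%N.

Definition discr : R :=
  (a 1%N * d 0%N + b 0%N * b 1%N - a 0%N * d 1%N - c 0%N * c 1%N) ^+ 2
  + 4 * (a 0%N * b 1%N + a 1%N * c 0%N) * (b 0%N * d 1%N + c 1%N * d 0%N).

Definition lambda1 : R :=
  (a 1%N * d 0%N + b 0%N * b 1%N + a 0%N * d 1%N + c 0%N * c 1%N
   + Num.sqrt discr) / 2.

Definition lambda2 : R :=
  (a 1%N * d 0%N + b 0%N * b 1%N + a 0%N * d 1%N + c 0%N * c 1%N
   - Num.sqrt discr) / 2.

Definition C1 (u0 v0 : R) : R :=
  (a 0%N * b 1%N + a 1%N * c 0%N) / (lambda1 - lambda2)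
  * ((b 0%N * d 1%N + c 1%N * d 0%N)
       / (lambda1 - (a 1%N * d 0%N + b 0%N * b 1%N)) * u0 + v0).

Definition C3 (u0 v0 : R) : R :=
  (b 0%N * d 1%N + c 1%N * d 0%N) / (lambda1 - lambda2) * u0
  + (lambda1 - (a 1%N * d 0%N + b 0%N * b 1%N)) / (lambda1 - lambda2) * v0.

Definition criterion (u0 v0 : R) : R :=
  C1 u0 v0 * lambda1 / C3 u0 v0
  - (b 0%N * (C1 u0 v0 / C3 u0 v0) + a 0%N)
    * (d 0%N * (C1 u0 v0 / C3 u0 v0) + c 0%N).

End Constants.

(* Main.v *)
Require Import Defs.
From HB Require Import structures.
From mathcomp Require Import all_boot all_order all_algebra.
From mathcomp Require Import all_classical all_reals all_analysis.
From mathcomp Require Import ring lra zify.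

Set Implicit Arguments.
Unset Strict Implicit.
Unset Printing Implicit Defensive.

Import Order.TTheory GRing.Theory Num.Theory.
Import numFieldNormedType.Exports.

(** The ratio [x n / y n] evolves by a Moebius map, so two steps of the system
act on the direction of [(x, y)] at even times by the positive matrix with
rows [(p, q)] and [(s, t)] (in the notations below). More precisely, two steps
send [(u, v)] to [gain u v / l1] times the image of [(u, v)] under this matrix,
where
[[
  gain u v = l1 * u * v / ((b 0 * u + a 0 * v) * (d 0 * u + c 0 * v))
]]
depends only on the direction of [(u, v)]. The largest eigenvalue [l1] of the
matrix has the positive eigenvector [(q, h)] with [h = l1 - p], and
[C1 / C3 = q / h] for all positive initial values. The criterion therefore does
not depend on the solution, and its sign is that of [gain q h - 1]
([criterion_lt0E], [criterion_gt0E]).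

To follow directions and sizes separately, pair the even terms with the left
eigenvectors of the matrix: [level = s * x + h * y] for [l1] and
[skew = h * x - q * y] for [l2]. Over two steps [level] is multiplied by the
gain and [skew] by [l2 / l1] times the gain. Hence [skew / level] is exactly
geometric with ratio of modulus less than 1 ([tilt_geometric]), the direction
tends to that of [(q, h)], and the gain tends to [gain q h]
([even_gain_cvg]). If this limit is below 1, then [level] tends to 0; if it is
above 1, then [level] tends to infinity; and the even terms are asymptotically
positive multiples of [level].

If [gain q h = 1], convergence of the gain to 1 is not enough. But then the
quadratic form in the numerator of [gain u v - 1] vanishes at [(q, h)], so it
has the factor [h * u - q * v], and [gain - 1] is bounded by a multiple of
[skew / level] ([gain_sub1_le]). It is geometrically small, so the product of
the gains converges to a positive number, and so does [level].

The odd terms are read off from one step of the system. When the even terms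
have positive limits, passing to the limit in the system shows that the limits
form a two-periodic solution. *)

Local Open Scope classical_set_scope.
Local Open Scope ring_scope.

(** * Sequences of positive numbers *)

Lemma ratio_gt0 (R : realType) (z g : nat -> R) :
  (forall n, 0 < z n) -> (forall n, z n.+1 = g n * z n) ->
  forall n, 0 < g n.
Proof.
by move=> z_gt0 z_rec n; have := z_gt0 n.+1; rewrite z_rec pmulr_lgt0.
Qed.

(** From some index on the ratios are below [theta < 1], so that the sequence
is dominated by a geometric one. *)
Lemma ratio_lt1_cvg0 (R : realType) (z g : nat -> R) (rho : R) :
  (forall n, 0 < z n) -> (forall n, z n.+1 = g n * z n) ->
  g n @[n --> \oo] --> rho -> rho < 1 -> z n @[n --> \oo] --> (0 : R).
Proof.
move=> z_gt0 z_rec g_rho rho_lt1; pose theta : R := (1 + rho) / 2.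
have [N _ g_theta] : \forall n \near \oo, g n < theta.
  by apply: (cvgr_lt rho g_rho); rewrite /theta; lra.
have theta_gt0 : 0 < theta := lt_trans (ratio_gt0 z_gt0 z_rec N) (g_theta N (leqnn N)).
have theta_lt1 : theta < 1 by rewrite /theta; lra.
have norm_theta : `|theta| < 1 by rewrite gtr0_norm.
rewrite -(cvg_shiftn N).
apply: (squeeze_cvgr _ (cvg_cst 0) (cvg_geometric (z N) norm_theta)).
near=> n; rewrite ltW //=; elim: (n) => [|m IHm]; first by rewrite expr0 mulr1.
rewrite addSn z_rec exprS mulrCA ler_pM // ?ltW ?(ratio_gt0 z_gt0 z_rec) //.
by apply: g_theta; rewrite /= leq_addl.
Unshelve. all: by end_near.
Qed.

Lemma ratio_gt1_cvgy (R : realType) (z g : nat -> R) (rho : R) :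
  (forall n, 0 < z n) -> (forall n, z n.+1 = g n * z n) ->
  g n @[n --> \oo] --> rho -> 1 < rho -> z n @[n --> \oo] --> +oo.
Proof.
move=> z_gt0 z_rec g_rho rho_gt1; have rho_gt0 : 0 < rho by apply: lt_trans rho_gt1.
apply/gtr0_cvgV0; first exact: nearW.
apply: (@ratio_lt1_cvg0 _ _ (fun n => (g n)^-1) rho^-1).
- by move=> n; rewrite invr_gt0.
- by move=> n; rewrite /= z_rec invfM.
- by apply: cvgV => //; rewrite gt_eqF.
- by rewrite invf_lt1.
Qed.

(** Since [`|ln (g n)|] is at most a constant times [`|g n - 1|], the series of
the [ln (g n)], whose partial sums are [ln (z n) - ln (z 0)], converges
absolutely. Working with logarithms excludes the limit 0. *)
Lemma ratio_geometric_cvg (R : realType) (z g : nat -> R) (K k : R) :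
  (forall n, 0 < z n) -> (forall n, z n.+1 = g n * z n) ->
  0 <= k < 1 ->
  (forall n, `|g n - 1| <= K * k ^+ n) ->
  exists2 l : R, 0 < l & z n @[n --> \oo] --> l.
Proof.
move=> z_gt0 z_rec /andP[k_ge0 k_lt1] g1K.
have norm_k : `|k| < 1 by rewrite ger0_norm.
have Kk0 := @cvg_geometric R K k norm_k.
have g_1 : g n @[n --> \oo] --> (1 : R).
  apply/subr_cvg0; apply/norm_cvg0P.
  apply: (squeeze_cvgr _ (cvg_cst 0) Kk0).
  by near=> n; rewrite normr_ge0 /= g1K.
(* [- ln (g n)] is bounded by [(g n)^-1 - 1 = (g n)^-1 * (1 - g n)], which
   requires a bound on [(g n)^-1] valid from the first index on. *)
have [M [Mreal gV_M]] : bounded_fun (fun n => (g n)^-1).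
  apply: cvg_seq_bounded; apply/cvg_ex; exists 1^-1.
  by apply: cvgV => //; rewrite oner_neq0.
pose B := `|M| + 1.
have gV_B n : (g n)^-1 <= B.
  have MB : M < B by rewrite /B (le_lt_trans (ler_norm M))// ltrDl.
  exact: le_trans (ler_norm _) (gV_M B MB n I).
have B_ge1 : 1 <= B by rewrite /B lerDr.
have ln_g n : `|ln (g n)| <= B * (K * k ^+ n).
  have g0 := ratio_gt0 z_gt0 z_rec n; have gK := g1K n.
  have lnV : ln (g n)^-1 = - ln (g n) by rewrite lnV.
  have up : ln (g n) <= g n - 1.
    by rewrite -[X in ln X](subrKC 1) le_ln1Dx // ltrBrDl subrr.
  have lo : - ln (g n) <= (g n)^-1 - 1.
    by rewrite -lnV -[X in ln X](subrKC 1) le_ln1Dx // ltrBrDl subrr invr_gt0.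
  have lo' : (g n)^-1 - 1 = (g n)^-1 * (1 - g n).
    by rewrite mulrBr mulr1 mulVf // gt_eqF.
  have gV0 : 0 < (g n)^-1 by rewrite invr_gt0.
  have gVB := gV_B n.
  rewrite ler_norml; apply/andP; split; last first.
    apply: (le_trans up); apply: (le_trans (ler_norm _)); apply: (le_trans gK).
    by rewrite ler_peMl // (le_trans _ gK).
  rewrite lerNl; apply: (le_trans lo); rewrite lo'.
  apply: (le_trans (ler_norm _)); rewrite normrM (gtr0_norm gV0) distrC.
  by rewrite ler_pM // ltW.
pose logz n := ln (z n).
have ln_z n : telescope logz n = ln (g n).
  rewrite /telescope /logz /= z_rec lnM ?posrE ?(ratio_gt0 z_gt0 z_rec) //; ring.
have cv : cvgn (series (telescope logz)).
  apply: normed_cvg; apply: (@series_le_cvg _ _ (geometric (B * K) k)) => /=.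
  - by move=> n; exact: normr_ge0.
  - move=> n; rewrite -mulrA; exact: le_trans (normr_ge0 _) (ln_g n).
  - by move=> n; rewrite ln_z -mulrA ln_g.
  - exact: is_cvg_geometric_series.
move/cvg_ex: cv => [L]; rewrite telescopeK => cvL.
exists (expR (L + ln (z 0%N))); first exact: expR_gt0.
have cv' : ln (z n) @[n --> \oo] --> L + ln (z 0%N).
  rewrite (_ : (fun n => ln (z n)) = fun n => (logz n - logz 0%N) + ln (z 0%N)).
    by apply: cvgD => //; exact: cvg_cst.
  by apply/funext => n; rewrite subrK.
have cvz : expR (ln (z n)) @[n --> \oo] --> expR (L + ln (z 0%N)).
  by apply: continuous_cvg cv' => //; exact: continuous_expR.
rewrite (_ : z @ \oo = expR (ln (z n)) @[n --> \oo]) //.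
by congr (_ @ \oo); apply/funext => n; rewrite /= lnK // posrE.
Unshelve. all: by end_near.
Qed.

Section sum_of_quotients.
Variables (R : realType) (u v : nat -> R) (al be : R).
Hypotheses (al_gt0 : 0 < al) (be_gt0 : 0 < be).
Hypotheses (u_gt0 : forall n, 0 < u n) (v_gt0 : forall n, 0 < v n).

Lemma cvg_div_add_div (l m : R) : 0 < l -> 0 < m ->
  u n @[n --> \oo] --> l -> v n @[n --> \oo] --> m ->
  al / u n + be / v n @[n --> \oo] --> al / l + be / m.
Proof.
move=> l_gt0 m_gt0 u_l v_m.
by apply: cvgD; apply: cvgMr; apply: cvgV => //; exact: lt0r_neq0.
Qed.

Lemma div_add_div_cvg0 :
  u n @[n --> \oo] --> +oo -> v n @[n --> \oo] --> +oo ->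
  al / u n + be / v n @[n --> \oo] --> (0 : R).
Proof.
move=> u_y v_y; have -> : 0 = al * 0 + be * 0 :> R by rewrite !mulr0 addr0.
by apply: cvgD; apply: cvgMr; apply/gtr0_cvgV0 => //; exact: nearW.
Qed.

Lemma div_add_div_cvgy :
  u n @[n --> \oo] --> (0 : R) -> al / u n + be / v n @[n --> \oo] --> +oo.
Proof.
move=> u_0.
have sum_gt n : al / u n < al / u n + be / v n by rewrite ltrDl divr_gt0.
have quot_gt0 n : 0 < al / u n by rewrite divr_gt0.
have sum_gt0 n : 0 < al / u n + be / v n := lt_trans (quot_gt0 n) (sum_gt n).
apply/gtr0_cvgV0; first exact: nearW.
have au_0 : u n / al @[n --> \oo] --> (0 : R).
  by rewrite -(mul0r al^-1); exact: cvgMl.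
apply: (squeeze_cvgr _ (cvg_cst 0) au_0); apply: nearW => n /=.
by rewrite invr_ge0 (ltW (sum_gt0 n)) /= -[leRHS]invf_div lef_pV2 ?posrE // ltW.
Qed.
End sum_of_quotients.

Lemma cvgy_of_quotient (R : realType) (w z : nat -> R) (l : R) :
  (forall n, 0 < z n) -> 0 < l -> z n @[n --> \oo] --> +oo ->
  w n / z n @[n --> \oo] --> l -> w n @[n --> \oo] --> +oo.
Proof.
move=> z_gt0 l_gt0 z_y wz_l.
have w_gt0 : \forall n \near \oo, 0 < w n.
  have [N _ wz_gt0] := cvgr_gt l wz_l 0 l_gt0; exists N => // n /wz_gt0 /=.
  by rewrite pmulr_lgt0 // invr_gt0.
apply/gtr0_cvgV0 => //.
have zV_0 : (z n)^-1 @[n --> \oo] --> (0 : R).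
  by apply/gtr0_cvgV0 => //; exact: nearW.
have wVE : (fun n => (w n)^-1) = fun n => (w n / z n)^-1 * (z n)^-1.
  by apply/funext => n; rewrite invf_div mulrAC divff ?mul1r // lt0r_neq0.
have : (fun n => (w n)^-1) @ \oo --> l^-1 * 0.
  by rewrite wVE; apply: cvgM zV_0; apply: cvgV => //; exact: lt0r_neq0.
by rewrite mulr0.
Qed.

Lemma cvg_even_odd (T : topologicalType) (u : nat -> T) (l : T) :
  u (2 * n)%N @[n --> \oo] --> l -> u (2 * n + 1)%N @[n --> \oo] --> l ->
  u n @[n --> \oo] --> l.
Proof.
move=> even_l odd_l A Al.
have [N1 _ uN1] := even_l A Al; have [N2 _ uN2] := odd_l A Al.
exists (2 * (N1 + N2))%N => // n /= le_n.
have nE := odd_double_half n.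
case: (odd n) nE => nE; rewrite -nE -mul2n.
  by rewrite addnC; apply: uN2 => /=; lia.
by rewrite add0n; apply: uN1 => /=; lia.
Qed.

Lemma cvg_sub_alternating (R : realType) (u : nat -> R) (l m : R) :
  u (2 * n)%N @[n --> \oo] --> l -> u (2 * n + 1)%N @[n --> \oo] --> m ->
  u n - (if odd n then m else l) @[n --> \oo] --> (0 : R).
Proof.
move=> even_l odd_m; have odd2 n : odd (2 * n) = false by rewrite mul2n odd_double.
apply: (@cvg_even_odd _ (fun n => u n - (if odd n then m else l))).
  under eq_fun do rewrite odd2.
  exact/subr_cvg0.
under eq_fun do rewrite addn1 /= odd2 -addn1.
exact/subr_cvg0.
Qed.

Lemma periodic2E (T : Type) (u : nat -> T) :
  periodic_seq 2 u -> forall n, u n = u (odd n).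
Proof.
move=> u_per n; elim/ltn_ind: n => -[|[|n]] // IHn.
by rewrite -(addn2 n) u_per addn2 /= negbK IHn.
Qed.

(** * The two-step matrix and its dominant eigenvector *)

Section two_step.
Variables (R : realType) (a b c d : nat -> R).
Hypotheses (a_gt0 : forall n, 0 < a n) (b_gt0 : forall n, 0 < b n).
Hypotheses (c_gt0 : forall n, 0 < c n) (d_gt0 : forall n, 0 < d n).

(* [p], [q] and [s], [t] are the rows of the two-step matrix, and [(q, h)] is its
   eigenvector for [l1]. *)
Local Notation p := (a 1%N * d 0%N + b 0%N * b 1%N).
Local Notation q := (a 0%N * b 1%N + a 1%N * c 0%N).
Local Notation s := (b 0%N * d 1%N + c 1%N * d 0%N).
Local Notation t := (a 0%N * d 1%N + c 0%N * c 1%N).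
Local Notation l1 := (lambda1 a b c d).
Local Notation l2 := (lambda2 a b c d).
Local Notation h := (l1 - p).

Let p_gt0 : 0 < p. Proof. by rewrite addr_gt0 // mulr_gt0. Qed.
Let q_gt0 : 0 < q. Proof. by rewrite addr_gt0 // mulr_gt0. Qed.
Let s_gt0 : 0 < s. Proof. by rewrite addr_gt0 // mulr_gt0. Qed.
Let t_gt0 : 0 < t. Proof. by rewrite addr_gt0 // mulr_gt0. Qed.

Lemma lambda_sum : l1 + l2 = p + t.
Proof. by rewrite /lambda1 /lambda2; field. Qed.

Lemma discr_gt : (p - t) ^+ 2 < discr a b c d.
Proof.
have -> : discr a b c d = (p - t) ^+ 2 + 4 * (q * s) by rewrite /discr; ring.
by rewrite ltrDl mulr_gt0 // mulr_gt0.
Qed.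

Lemma lambda_prod : l1 * l2 = p * t - q * s.
Proof.
have discr_ge0 : 0 <= discr a b c d.
  exact: le_trans (sqr_ge0 _) (ltW discr_gt).
have -> : l1 * l2 = ((p + t) ^+ 2 - Num.sqrt (discr a b c d) ^+ 2) / 4.
  by rewrite /lambda1 /lambda2; field.
by rewrite sqr_sqrtr // /discr; field.
Qed.

(** The off-diagonal product [q * s] is positive, so the square root of the
discriminant exceeds [`|p - t|]. *)
Lemma perron_gap_gt0 : 0 < h.
Proof.
have : p - t < Num.sqrt (discr a b c d).
  apply: (le_lt_trans (ler_norm _)); rewrite -sqrtr_sqr ltr_sqrt ?discr_gt //.
  exact: le_lt_trans (sqr_ge0 _) discr_gt.
by rewrite /lambda1; lra.
Qed.
Let h_gt0 := perron_gap_gt0.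

Lemma lambda1_gt0 : 0 < l1.
Proof. by have := h_gt0; have := p_gt0; lra. Qed.
Let l1_gt0 := lambda1_gt0.

Lemma lambda_ratio_lt1 : `|l2 / l1| < 1.
Proof.
have sqrt_gt0 : 0 < Num.sqrt (discr a b c d).
  by rewrite sqrtr_gt0 (le_lt_trans (sqr_ge0 _) discr_gt).
have lt_l2 : l2 < l1 by rewrite /lambda1 /lambda2; lra.
have gt_l2 : - l1 < l2 by have := lambda_sum; have := p_gt0; have := t_gt0; lra.
by rewrite ltr_norml ltr_pdivlMr // mulN1r gt_l2 ltr_pdivrMr // mul1r.
Qed.

(** The characteristic equation at [l1], in the form that makes [(s, h)] a left
eigenvector for [l1] and [(h, - q)] one for [l2]. *)
Lemma perron_eq : h * (l1 - t) = q * s.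
Proof. by have := lambda_prod; have := lambda_sum; nra. Qed.

(** Both constants are multiples of the value of the left eigenvector
[(s, h)] at [(u0, v0)], which cancels in the quotient. *)
Lemma perron_ratio u0 v0 : 0 < u0 -> 0 < v0 ->
  C1 a b c d u0 v0 / C3 a b c d u0 v0 = q / h.
Proof.
move=> u0_gt0 v0_gt0; rewrite /C1 /C3.
have gap_gt0 : 0 < l1 - l2.
  by move: lambda_ratio_lt1; rewrite ltr_norml => /andP[_];
     rewrite ltr_pdivrMr // mul1r subr_gt0.
have psi_gt0 : 0 < s * u0 + h * v0 by rewrite addr_gt0 // mulr_gt0.
by field; rewrite !gt_eqF.
Qed.

(** The factor by which two steps starting at an even time with the values
[(u, v)] multiply the left eigenvector for [l1]. *)
Definition gain (u v : R) : R :=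
  l1 * u * v / ((b 0%N * u + a 0%N * v) * (d 0%N * u + c 0%N * v)).

Lemma gain_scale k u v : k != 0 -> gain (u / k) (v / k) = gain u v.
Proof.
move=> k_neq0; rewrite /gain.
rewrite [X in _ = l1 * u * v / X](_ : _ = k ^+ 2
    * ((b 0%N * (u / k) + a 0%N * (v / k)) * (d 0%N * (u / k) + c 0%N * (v / k)))).
  by rewrite [in RHS]invfM [RHS]mulrA; congr (_ / _); field.
by field.
Qed.

Lemma criterionE u0 v0 : 0 < u0 -> 0 < v0 ->
  criterion a b c d u0 v0
  = (gain q h - 1) * (b 0%N * q + a 0%N * h) * (d 0%N * q + c 0%N * h) / h ^+ 2.
Proof.
move=> u0_gt0 v0_gt0; rewrite /criterion mulrAC perron_ratio // /gain.
have bq : 0 < b 0%N * q + a 0%N * h by rewrite addr_gt0 // mulr_gt0.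
have dq : 0 < d 0%N * q + c 0%N * h by rewrite addr_gt0 // mulr_gt0.
by field; rewrite !gt_eqF.
Qed.

Lemma criterion_gt0E u0 v0 : 0 < u0 -> 0 < v0 ->
  (0 < criterion a b c d u0 v0) = (1 < gain q h).
Proof.
move=> u0_gt0 v0_gt0; rewrite criterionE // pmulr_lgt0 ?invr_gt0 ?exprn_gt0 //.
by rewrite !pmulr_lgt0 ?subr_gt0 // addr_gt0 // mulr_gt0.
Qed.

Lemma criterion_lt0E u0 v0 : 0 < u0 -> 0 < v0 ->
  (criterion a b c d u0 v0 < 0) = (gain q h < 1).
Proof.
move=> u0_gt0 v0_gt0; rewrite criterionE // pmulr_llt0 ?invr_gt0 ?exprn_gt0 //.
by rewrite !pmulr_llt0 ?subr_lt0 // addr_gt0 // mulr_gt0.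
Qed.

(** Under [gain q h = 1] the quadratic form
[l1 * u * v - (b 0 * u + a 0 * v) * (d 0 * u + c 0 * v)] vanishes at [(q, h)].
The other linear factor is forced by the coefficients of [u ^+ 2] and
[v ^+ 2]. *)
Lemma gain_sub1 u v : 0 < u -> 0 < v -> gain q h = 1 ->
  gain u v - 1 = (h * u - q * v) * (a 0%N * c 0%N / q * v - b 0%N * d 0%N / h * u)
     / ((b 0%N * u + a 0%N * v) * (d 0%N * u + c 0%N * v)).
Proof.
move=> u_gt0 v_gt0; rewrite /gain.
have : 0 < b 0%N * u + a 0%N * v by rewrite addr_gt0 // mulr_gt0.
have : 0 < d 0%N * u + c 0%N * v by rewrite addr_gt0 // mulr_gt0.
have : 0 < b 0%N * q + a 0%N * h by rewrite addr_gt0 // mulr_gt0.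
have : 0 < d 0%N * q + c 0%N * h by rewrite addr_gt0 // mulr_gt0.
(* [l1] also occurs in [h]; the identity only needs the relation between [l1],
   [q] and [h] given by [gain q h = 1], so the three become independent. *)
move: h_gt0 q_gt0; move: (l1) (q) (h) => l r g g0 r0 dr_gt0 br_gt0 du_gt0 bu_gt0.
move=> /divr1_eq lE.
have -> : l = (b 0%N * r + a 0%N * g) * (d 0%N * r + c 0%N * g) / (r * g).
  by rewrite -lE; field; rewrite !gt_eqF.
by field; rewrite !gt_eqF.
Qed.

(** The absolute value of the remaining factor in [gain_sub1] times [s * u + h * v] is
at most a constant times the denominator of the gain. Each summand of the
constant compares one coefficient of these two positive quadratic forms, at
[u ^+ 2], [v ^+ 2] and [u * v] respectively. *)
Lemma gain_sub1_le u v : 0 < u -> 0 < v -> gain q h = 1 ->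
  `|gain u v - 1| <= (s / h + h / q
      + (b 0%N * d 0%N + s * (a 0%N * c 0%N) / q) / (a 0%N * d 0%N + b 0%N * c 0%N))
    * `|(h * u - q * v) / (s * u + h * v)|.
Proof.
move=> u_gt0 v_gt0 gain1; rewrite gain_sub1 //.
have psi_gt0 : 0 < s * u + h * v by rewrite addr_gt0 // mulr_gt0.
have bu_gt0 : 0 < b 0%N * u + a 0%N * v by rewrite addr_gt0 // mulr_gt0.
have du_gt0 : 0 < d 0%N * u + c 0%N * v by rewrite addr_gt0 // mulr_gt0.
move: h_gt0 q_gt0 s_gt0 psi_gt0.
move: (s) (q) (h) => w r g g0 r0 w0 psi_gt0.
set L := _ * (d 0%N * u + c 0%N * v); have L_gt0 : 0 < L by rewrite mulr_gt0.
set al := a 0%N * c 0%N / r * v; set be := b 0%N * d 0%N / g * u.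
have al_gt0 : 0 < al by rewrite !mulr_gt0 // invr_gt0.
have be_gt0 : 0 < be by rewrite !mulr_gt0 // invr_gt0.
set K := (X in X * _).
rewrite !normrM !normfV (gtr0_norm psi_gt0) (gtr0_norm L_gt0).
rewrite -mulrA [leRHS]mulrCA ler_wpM2l //.
rewrite ler_pdivrMr // mulrAC ler_pdivlMr //.
have : `|al - be| <= al + be by rewrite ler_norml; apply/andP; split; lra.
move=> /(ler_wpM2r (ltW psi_gt0)) /le_trans; apply.
have adbc_gt0 : 0 < a 0%N * d 0%N + b 0%N * c 0%N.
  by rewrite addr_gt0 // mulr_gt0.
(* After cancelling the matched coefficients only positive terms remain. *)
rewrite -subr_ge0 [X in 0 <= X](_ : _ =
    w / g * ((a 0%N * d 0%N + b 0%N * c 0%N) * (u * v) + a 0%N * c 0%N * v ^+ 2)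
  + g / r * ((a 0%N * d 0%N + b 0%N * c 0%N) * (u * v) + b 0%N * d 0%N * u ^+ 2)
  + (b 0%N * d 0%N + w * (a 0%N * c 0%N) / r) / (a 0%N * d 0%N + b 0%N * c 0%N)
    * (b 0%N * d 0%N * u ^+ 2 + a 0%N * c 0%N * v ^+ 2)).
  by do ?[apply: exprn_gt0 | apply: divr_gt0 | apply: mulr_gt0 | apply: addr_gt0 | apply: ltW].
by rewrite /K /L /al /be; field; rewrite !gt_eqF.
Qed.

(** * Dynamics of the even terms *)

Hypotheses (a_per : periodic_seq 2 a) (b_per : periodic_seq 2 b).
Hypotheses (c_per : periodic_seq 2 c) (d_per : periodic_seq 2 d).

Section orbit.
Variables (x y : nat -> R).
Hypotheses (x0_gt0 : 0 < x 0%N) (y0_gt0 : 0 < y 0%N).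
Hypothesis xy_sol : is_solution a b c d x y.

Lemma solution_gt0 n : 0 < x n /\ 0 < y n.
Proof.
elim: n => [//|n [x_gt0 y_gt0]]; have [-> ->] := xy_sol n.
by split; apply: addr_gt0; apply: divr_gt0.
Qed.
Let x_gt0 n : 0 < x n. Proof. by case: (solution_gt0 n). Qed.
Let y_gt0 n : 0 < y n. Proof. by case: (solution_gt0 n). Qed.

Lemma odd_step n :
  x (2 * n + 1)%N = a 0%N / x (2 * n)%N + b 0%N / y (2 * n)%N
  /\ y (2 * n + 1)%N = c 0%N / x (2 * n)%N + d 0%N / y (2 * n)%N.
Proof.
rewrite addn1; have [-> ->] := xy_sol (2 * n)%N.
have odd2 : odd (2 * n) = false by rewrite mul2n odd_double.
by rewrite (periodic2E a_per) (periodic2E b_per) (periodic2E c_per)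
  (periodic2E d_per) odd2.
Qed.

Lemma even_step n :
  x (2 * n.+1)%N = a 1%N / x (2 * n + 1)%N + b 1%N / y (2 * n + 1)%N
  /\ y (2 * n.+1)%N = c 1%N / x (2 * n + 1)%N + d 1%N / y (2 * n + 1)%N.
Proof.
rewrite mulnS add2n addn1; have [-> ->] := xy_sol (2 * n).+1.
have odd2 : odd (2 * n).+1 by rewrite /= mul2n odd_double.
by rewrite (periodic2E a_per) (periodic2E b_per) (periodic2E c_per)
  (periodic2E d_per) odd2.
Qed.

(** The odd terms converge by one step of the system, and one further step
expresses the even limits in terms of the odd ones, by uniqueness of
limits. *)
Lemma solution_cvg_two_periodic (X0 Y0 : R) : 0 < X0 -> 0 < Y0 ->
  x (2 * n)%N @[n --> \oo] --> X0 -> y (2 * n)%N @[n --> \oo] --> Y0 ->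
  exists X Y : nat -> R,
    [/\ is_solution a b c d X Y,
        periodic_seq 2 (fun n => (X n, Y n)),
        forall n, 0 < X n /\ 0 < Y n &
        converges_to x y X Y].
Proof.
move=> X0_gt0 Y0_gt0 x_even y_even.
pose X1 := a 0%N / X0 + b 0%N / Y0; pose Y1 := c 0%N / X0 + d 0%N / Y0.
have X1_gt0 : 0 < X1 by rewrite addr_gt0 // divr_gt0.
have Y1_gt0 : 0 < Y1 by rewrite addr_gt0 // divr_gt0.
have x_odd : x (2 * n + 1)%N @[n --> \oo] --> X1.
  under eq_fun do rewrite (odd_step _).1.
  exact: cvg_div_add_div.
have y_odd : y (2 * n + 1)%N @[n --> \oo] --> Y1.
  under eq_fun do rewrite (odd_step _).2.
  exact: cvg_div_add_div.
have X0E : X0 = a 1%N / X1 + b 1%N / Y1.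
  have x_even' : x (2 * n.+1)%N @[n --> \oo] --> X0.
    by move: x_even; rewrite -cvg_shiftS.
  have x_even'' : x (2 * n.+1)%N @[n --> \oo] --> a 1%N / X1 + b 1%N / Y1.
    under eq_fun do rewrite (even_step _).1.
    exact: cvg_div_add_div.
  exact: (cvg_unique (@Rhausdorff R) x_even' x_even'').
have Y0E : Y0 = c 1%N / X1 + d 1%N / Y1.
  have y_even' : y (2 * n.+1)%N @[n --> \oo] --> Y0.
    by move: y_even; rewrite -cvg_shiftS.
  have y_even'' : y (2 * n.+1)%N @[n --> \oo] --> c 1%N / X1 + d 1%N / Y1.
    under eq_fun do rewrite (even_step _).2.
    exact: cvg_div_add_div.
  exact: (cvg_unique (@Rhausdorff R) y_even' y_even'').
exists (fun n => if odd n then X1 else X0), (fun n => if odd n then Y1 else Y0).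
split.
- move=> n; rewrite (periodic2E a_per n) (periodic2E b_per n).
  rewrite (periodic2E c_per n) (periodic2E d_per n) /=.
  by case: (odd n).
- by move=> n; rewrite addn2 /= negbK.
- by move=> n; case: (odd n).
by split; exact: cvg_sub_alternating.
Qed.

Let even_gain n := gain (x (2 * n)%N) (y (2 * n)%N).

(** Two steps divide by [x * y] at two consecutive times; the two divisions
combine into the scalar [even_gain n / l1] in front of the matrix product. *)
Lemma two_step_gain n (u := x (2 * n)%N) (v := y (2 * n)%N) :
  x (2 * n.+1)%N = even_gain n / l1 * (p * u + q * v)
  /\ y (2 * n.+1)%N = even_gain n / l1 * (s * u + t * v).
Proof.
have [-> ->] := even_step n; have [-> ->] := odd_step n.
rewrite /even_gain /gain -/u -/v.
have u_gt0 : 0 < u := x_gt0 _; have v_gt0 : 0 < v := y_gt0 _.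
have bu_gt0 : 0 < b 0%N * u + a 0%N * v by rewrite addr_gt0 // mulr_gt0.
have du_gt0 : 0 < d 0%N * u + c 0%N * v by rewrite addr_gt0 // mulr_gt0.
have av_gt0 : 0 < a 0%N * v + b 0%N * u by rewrite addrC.
have cv_gt0 : 0 < c 0%N * v + d 0%N * u by rewrite addrC.
move: l1_gt0; move: (l1) => l l_gt0.
by split; field; rewrite !gt_eqF.
Qed.

(** The even terms evaluated at the left eigenvectors of the two-step matrix,
[level] for [l1] and [skew] for [l2]. They serve as coordinates in which the
matrix is diagonal. *)
Definition level n := s * x (2 * n)%N + h * y (2 * n)%N.
Definition skew n := h * x (2 * n)%N - q * y (2 * n)%N.

Lemma level_gt0 n : 0 < level n.
Proof. by rewrite addr_gt0 // mulr_gt0. Qed.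

Lemma level_rec n : level n.+1 = even_gain n * level n.
Proof.
rewrite /level; have [-> ->] := two_step_gain n.
rewrite -[X in _ = X * _](divfK (lt0r_neq0 l1_gt0)).
move: (_ / l1) (x (2 * n)%N) (y (2 * n)%N) => k u v.
transitivity (k * (l1 * s * u + (q * s + h * t) * v)); first by ring.
by rewrite -perron_eq; ring.
Qed.

Lemma skew_rec n : skew n.+1 = l2 / l1 * even_gain n * skew n.
Proof.
rewrite /skew; have [-> ->] := two_step_gain n.
rewrite [RHS](_ : _ = even_gain n / l1 * (l2 * (h * x (2 * n)%N - q * y (2 * n)%N))).
  move: (even_gain n / l1) (x (2 * n)%N) (y (2 * n)%N) => k u v.
  have -> : l2 = p + t - l1 by rewrite -lambda_sum; ring.
  transitivity (k * ((h * p - q * s) * u + q * (l1 - p - t) * v)); first by ring.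
  by rewrite -perron_eq; ring.
by ring.
Qed.

(** The gain cancels in the quotient, so the direction of the even terms follows
the linear dynamics alone. *)
Lemma tilt_geometric n :
  skew n / level n = skew 0 / level 0 * (l2 / l1) ^+ n.
Proof.
elim: n => [|n IHn]; first by rewrite mulr1.
rewrite exprSr mulrA -IHn skew_rec level_rec.
have g_gt0 : 0 < even_gain n by rewrite (ratio_gt0 level_gt0 level_rec).
by field; rewrite !gt_eqF // level_gt0.
Qed.

(* The determinant of the coordinate change from [(x, y)] to [(skew, level)]. *)
Let det := h ^+ 2 + q * s.
Let det_gt0 : 0 < det.
Proof. by apply: addr_gt0; [exact: exprn_gt0 | exact: mulr_gt0]. Qed.

(** Solving for [x] and [y] in terms of [level] and [skew] makes the quotients
affine functions of [skew / level], which tends to 0. *)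
Lemma even_div_level :
  x (2 * n)%N / level n @[n --> \oo] --> q / det /\
  y (2 * n)%N / level n @[n --> \oo] --> h / det.
Proof.
have e0 : skew n / level n @[n --> \oo] --> (0 : R).
  under eq_fun do rewrite tilt_geometric.
  exact: cvg_geometric lambda_ratio_lt1.
split.
  have -> : (fun n => x (2 * n)%N / level n)
      = (fun n => (q + h * (skew n / level n)) / det).
    apply/funext => n; rewrite /det /skew; have := level_gt0 n.
    rewrite /level; have := det_gt0; rewrite /det => *.
    by field; rewrite !gt_eqF.
  have -> : q / det = (q + h * 0) / det by rewrite mulr0 addr0.
  by apply: cvgMl; apply: cvgD; [exact: cvg_cst | exact: cvgMr].
have -> : (fun n => y (2 * n)%N / level n)
    = (fun n => (h - s * (skew n / level n)) / det).
  apply/funext => n; rewrite /det /skew; have := level_gt0 n.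
  rewrite /level; have := det_gt0; rewrite /det => *.
  by field; rewrite !gt_eqF.
have -> : h / det = (h - s * 0) / det by rewrite mulr0 subr0.
by apply: cvgMl; apply: cvgB; [exact: cvg_cst | exact: cvgMr].
Qed.

Lemma even_gain_cvg : even_gain n @[n --> \oo] --> gain q h.
Proof.
have [xl yl] := even_div_level.
have det_neq0 := lt0r_neq0 det_gt0.
rewrite -(gain_scale q h det_neq0).
have -> : even_gain = fun n => gain (x (2 * n)%N / level n) (y (2 * n)%N / level n).
  by apply/funext => n; rewrite gain_scale // (lt0r_neq0 (level_gt0 n)).
rewrite /gain; apply: cvgM.
  by apply: cvgM yl; exact: cvgMr.
have qd_gt0 : 0 < q / det by rewrite divr_gt0.
have hd_gt0 : 0 < h / det by rewrite divr_gt0.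
apply: cvgV.
  by rewrite lt0r_neq0 // mulr_gt0 // addr_gt0 // mulr_gt0.
by apply: cvgM; apply: cvgD; exact: cvgMr.
Qed.

Lemma even_cvg (l : R) : level n @[n --> \oo] --> l ->
  x (2 * n)%N @[n --> \oo] --> q / det * l /\
  y (2 * n)%N @[n --> \oo] --> h / det * l.
Proof.
move=> level_l; have [xl yl] := even_div_level.
have split_level (w : nat -> R) : (fun n => w (2 * n)%N)
    = fun n => w (2 * n)%N / level n * level n.
  by apply/funext => n; rewrite divfK // (lt0r_neq0 (level_gt0 n)).
by split; rewrite split_level; exact: cvgM.
Qed.

Lemma even_cvgy : level n @[n --> \oo] --> +oo ->
  x (2 * n)%N @[n --> \oo] --> +oo /\ y (2 * n)%N @[n --> \oo] --> +oo.
Proof.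
move=> level_y; have [xl yl] := even_div_level.
by split; [apply: (cvgy_of_quotient _ _ level_y xl) |
           apply: (cvgy_of_quotient _ _ level_y yl)];
  rewrite // ?divr_gt0 //; exact: level_gt0.
Qed.

(** * The three regimes *)

Lemma orbit_gain_lt1 : gain q h < 1 ->
  [/\ x (2 * n)%N @[n --> \oo] --> (0 : R),
      x (2 * n + 1)%N @[n --> \oo] --> +oo,
      y (2 * n)%N @[n --> \oo] --> (0 : R) &
      y (2 * n + 1)%N @[n --> \oo] --> +oo].
Proof.
move=> gain_lt1.
have level0 := ratio_lt1_cvg0 level_gt0 level_rec even_gain_cvg gain_lt1.
have [] := even_cvg level0; rewrite !mulr0 => x_even0 y_even0.
split=> //.
  under eq_fun do rewrite (odd_step _).1.
  exact: div_add_div_cvgy.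
under eq_fun do rewrite (odd_step _).2.
exact: div_add_div_cvgy.
Qed.

Lemma orbit_gain_gt1 : 1 < gain q h ->
  [/\ x (2 * n)%N @[n --> \oo] --> +oo,
      x (2 * n + 1)%N @[n --> \oo] --> (0 : R),
      y (2 * n)%N @[n --> \oo] --> +oo &
      y (2 * n + 1)%N @[n --> \oo] --> (0 : R)].
Proof.
move=> gain_gt1.
have level_y := ratio_gt1_cvgy level_gt0 level_rec even_gain_cvg gain_gt1.
have [x_even_y y_even_y] := even_cvgy level_y.
split=> //.
  under eq_fun do rewrite (odd_step _).1.
  exact: div_add_div_cvg0.
under eq_fun do rewrite (odd_step _).2.
exact: div_add_div_cvg0.
Qed.

(** The gains differ from 1 by at most a multiple of [skew / level], hence
geometrically little, so that [level] has a positive limit. *)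
Lemma orbit_gain_eq1 : gain q h = 1 ->
  exists X Y : nat -> R,
    [/\ is_solution a b c d X Y,
        periodic_seq 2 (fun n => (X n, Y n)),
        forall n, 0 < X n /\ 0 < Y n &
        converges_to x y X Y].
Proof.
move=> gain1.
have [l l_gt0 level_l] : exists2 l : R, 0 < l & level n @[n --> \oo] --> l.
  apply: (ratio_geometric_cvg level_gt0 level_rec (k := `|l2 / l1|)).
    by rewrite normr_ge0 lambda_ratio_lt1.
  move=> n; apply: (le_trans (gain_sub1_le _ _ gain1)) => //.
  by rewrite -/(skew n) -/(level n) tilt_geometric normrM normrX [leLHS]mulrA.
have [x_even y_even] := even_cvg level_l.
move: x_even y_even; set X0 := _ * l; set Y0 := _ * l => x_even y_even.
have X0_gt0 : 0 < X0 by rewrite mulr_gt0 // divr_gt0.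
have Y0_gt0 : 0 < Y0 by rewrite mulr_gt0 // divr_gt0.
exact: solution_cvg_two_periodic x_even y_even.
Qed.

End orbit.
End two_step.

Theorem theorem5 (R : realType) (a b c d : nat -> R)
  (a_gt0 : forall n, 0 < a n) (b_gt0 : forall n, 0 < b n)
  (c_gt0 : forall n, 0 < c n) (d_gt0 : forall n, 0 < d n)
  (a_per : periodic_seq 2 a) (b_per : periodic_seq 2 b)
  (c_per : periodic_seq 2 c) (d_per : periodic_seq 2 d)
  (a_neq : a 0%N <> a 1%N) (b_neq : b 0%N <> b 1%N)
  (c_neq : c 0%N <> c 1%N) (d_neq : d 0%N <> d 1%N)
  (rank2 : \rank (two_step_mx a b c d) = 2%N)
  (x y : nat -> R) (x0_gt0 : 0 < x 0%N) (y0_gt0 : 0 < y 0%N)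
  (xy_sol : is_solution a b c d x y) :
  [/\ criterion a b c d (x 0%N) (y 0%N) < 0 ->
        [/\ x (2 * n)%N @[n --> \oo] --> (0 : R),
            x (2 * n + 1)%N @[n --> \oo] --> +oo,
            y (2 * n)%N @[n --> \oo] --> (0 : R) &
            y (2 * n + 1)%N @[n --> \oo] --> +oo],
      0 < criterion a b c d (x 0%N) (y 0%N) ->
        [/\ x (2 * n)%N @[n --> \oo] --> +oo,
            x (2 * n + 1)%N @[n --> \oo] --> (0 : R),
            y (2 * n)%N @[n --> \oo] --> +oo &
            y (2 * n + 1)%N @[n --> \oo] --> (0 : R)] &
      criterion a b c d (x 0%N) (y 0%N) = 0 ->
        forall x' y' : nat -> R, 0 < x' 0%N -> 0 < y' 0%N ->
          is_solution a b c d x' y' ->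
          exists X Y : nat -> R,
            [/\ is_solution a b c d X Y,
                periodic_seq 2 (fun n => (X n, Y n)),
                forall n, 0 < X n /\ 0 < Y n &
                converges_to x' y' X Y]].
Proof.
have criterion_gt0 := criterion_gt0E a_gt0 b_gt0 c_gt0 d_gt0 x0_gt0 y0_gt0.
have criterion_lt0 := criterion_lt0E a_gt0 b_gt0 c_gt0 d_gt0 x0_gt0 y0_gt0.
rewrite criterion_gt0 criterion_lt0; split.
- exact: (orbit_gain_lt1 a_gt0 b_gt0 c_gt0 d_gt0 a_per b_per c_per d_per
            x0_gt0 y0_gt0 xy_sol).
- exact: (orbit_gain_gt1 a_gt0 b_gt0 c_gt0 d_gt0 a_per b_per c_per d_per
            x0_gt0 y0_gt0 xy_sol).
(* The vanishing criterion was evaluated at the given solution; [gain q h = 1]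
   no longer mentions it and applies to every other one. *)
move=> criterion0 x' y' x'0_gt0 y'0_gt0 xy'_sol.
apply: (orbit_gain_eq1 a_gt0 b_gt0 c_gt0 d_gt0) => //; apply/eqP.
by rewrite eq_le !leNgt -criterion_gt0 -criterion_lt0 criterion0 ltxx.
Qed.
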